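(* Let $(G,\tau,\oplus)$ be a topological gyrogroup and let $H$ be a closed strongly $L$-subgyrogroup of $G$. Let $G/H=\{a\oplus H: a\in G\}$ carry the quotient topology with respect to the natural mapping $\pi:G\to G/H$, $\pi(a)=a\oplus H$. Then $\pi$ is an open and continuous mapping, and $G/H$ is a homogeneous $T_1$-space.
   Context: A gyrogroup is a nonempty set $G$ with a binary operation $\oplus$ such that: (G1) there is an identity $0\in G$ with $0\oplus x=x=x\oplus 0$ for all $x\in G$; (G2) each $x\in G$ has an inverse $\ominus x$ with $\ominus x\oplus x=0=x\oplus(\ominus x)$; (G3) for all $x,y\in G$ there is an automorphism $\text{gyr}[x,y]$ of $(G,\oplus)$ with $x\oplus(y\oplus z)=(x\oplus y)\oplus\text{gyr}[x,y](z)$ for all $z\in G$; (G4) $\text{gyr}[x\oplus y,y]=\text{gyr}[x,y]$ for all $x,y\in G$. A topological gyrogroup $(G,\tau,\oplus)$ is a gyrogroup $(G,\oplus)$ with a topology $\tau$ such that $\oplus:G\times G\to G$ is (jointly) continuous and $x\mapsto\ominus x$ is continuous. Standing assumption: topological gyrogroups are Hausdorff. A nonempty subset $H\subseteq G$ is a subgyrogroup if $\oplus$ restricts to a binary operation on $H$, for all $x,y\in H$ the restriction of $\text{gyr}[x,y]$ to $H$ is a bijective homomorphism $H\to\text{gyr}[x,y](H)$, and $(H,\oplus|_{H\times H})$ is a gyrogroup. A subgyrogroup $H$ is a strongly $L$-subgyrogroup if $\text{gyr}[a,b](H)\subseteq H$ for all $a,b\in G$. For a strongly $L$-subgyrogroup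 $H$, the cosets $a\oplus H=\{a\oplus h:h\in H\}$ partition $G$. The quotient topology on $G/H$ consists of all $O\subseteq G/H$ such that $\pi^{-1}(O)$ is open in $G$. A space $X$ is homogeneous if for all $x,y\in X$ there is a homeomorphism of $X$ onto itself taking $x$ to $y$. *)

(* Defs.v *)
From HB Require Import structures.
From mathcomp Require Import all_boot.
From mathcomp Require Import all_classical.
From mathcomp Require Import topology.

Set Implicit Arguments.
Unset Strict Implicit.
Unset Printing Implicit Defensive.

Local Open Scope classical_set_scope.
Local Open Scope quotient_scope.

Definition magma_automorphism (T : Type) (op : T -> T -> T) (f : T -> T) : Prop :=
  bijective f /\ {morph f : x y / op x y}.

Record gyrogroup_axioms (T : Type) (op : T -> T -> T) (e : T) (inv : T -> T)
    (gyr : T -> T -> T -> T) : Prop := GyrogroupAxioms {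
  gyro_id : forall x, op e x = x /\ op x e = x ;
  gyro_inv : forall x, op (inv x) x = e /\ op x (inv x) = e ;
  gyro_aut : forall x y, magma_automorphism op (gyr x y) ;
  gyro_assoc : forall x y z, op x (op y z) = op (op x y) (gyr x y z) ;
  gyro_loop : forall x y, gyr (op x y) y =1 gyr x y
}.

Definition is_gyrogroup (T : Type) (op : T -> T -> T) : Prop :=
  exists e inv gyr, gyrogroup_axioms op e inv gyr.

HB.mixin Record isGyrogroup (T : Type) := {
  gyroadd : T -> T -> T ;
  gyrozero : T ;
  gyroopp : T -> T ;
  gyr : T -> T -> T -> T ;
  gyrogroupP : gyrogroup_axioms gyroadd gyrozero gyroopp gyr
}.

#[short(type="gyrogroupType")]
HB.structure Definition Gyrogroup := { T of isGyrogroup T }.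

Notation "x ⊕ y" := (gyroadd x y) (at level 50, left associativity).
Notation "⊖ x" := (gyroopp x) (at level 35, right associativity).

HB.mixin Record Gyrogroup_isTopological T of Topological T & Gyrogroup T := {
  gyroadd_continuous : continuous (fun p : T * T => p.1 ⊕ p.2) ;
  gyroopp_continuous : continuous (fun x : T => ⊖ x)
}.

(* Separation is not part of this structure. *)
#[short(type="topologicalGyrogroupType")]
HB.structure Definition TopologicalGyrogroup :=
  { T of Topological T & Gyrogroup T & Gyrogroup_isTopological T }.

(* The operation [op] in the last clause is necessarily the restriction of the
   operation of [G]; its existence says that [H] is closed under it. *)
Record subgyrogroup (G : gyrogroupType) (H : set G) : Prop := Subgyrogroup {
  subgyro_nonempty : H !=set0 ;
  subgyro_gyr : forall x y, H x -> H y ->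
    set_bij H (gyr x y @` H) (gyr x y) /\
    (forall a b, H a -> H b -> gyr x y (a ⊕ b) = gyr x y a ⊕ gyr x y b) ;
  subgyro_gyrogroup : exists op : set_type H -> set_type H -> set_type H,
    (forall a b, set_val (op a b) = set_val a ⊕ set_val b) /\ is_gyrogroup op
}.

Definition strongly_L_subgyrogroup (G : gyrogroupType) (H : set G) : Prop :=
  subgyrogroup H /\ forall a b, gyr a b @` H `<=` H.

Definition lcoset (G : gyrogroupType) (a : G) (H : set G) : set G :=
  [set a ⊕ h | h in H].

Definition lcosets (G : gyrogroupType) (H : set G) : set (set G) :=
  [set lcoset a H | a in [set: G]].

(* Wrapped so that the quotient structure below attaches to [coset_space]. *)
Definition coset_space (G : gyrogroupType) (H : set G) : Type :=
  set_type (lcosets H).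

Section CosetSpace.
Context (G : gyrogroupType) (H : set G).

HB.instance Definition _ := Choice.on (coset_space H).

Definition coset_pi (a : G) : coset_space H :=
  SigSub (mem_set (ex_intro2 _ _ a I erefl : lcosets H (lcoset a H))).

Fact coset_repr_subproof (A : coset_space H) : exists a, coset_pi a = A.
Proof.
by case: A => A hA; case: (set_mem hA) => a _ E; exists a; exact: val_inj.
Qed.

Definition coset_repr (A : coset_space H) : G :=
  projT1 (cid (coset_repr_subproof A)).

Fact coset_reprK : cancel coset_repr coset_pi.
Proof. by move=> A; exact: projT2 (cid (coset_repr_subproof A)). Qed.

HB.instance Definition _ :=
  isQuotient.Build G (coset_space H) coset_reprK.

End CosetSpace.

(* [G/H] with the quotient topology. *)
Notation gyroquotient H := (quotient_topology (coset_space H)).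

(* The natural mapping [a |-> a ⊕ H], with values in [gyroquotient H]. *)
Notation gyroproj H := (\pi_(gyroquotient H)).

Fact gyroprojE (G : topologicalGyrogroupType) (H : set G) (a : G) :
  gyroproj H a = coset_pi H a.
Proof. by rewrite !unlock. Qed.

Fact val_gyroproj (G : topologicalGyrogroupType) (H : set G) (a : G) :
  set_val (gyroproj H a : coset_space H) = [set a ⊕ h | h in H].
Proof. by rewrite gyroprojE. Qed.

Fact open_gyroquotient (G : topologicalGyrogroupType) (H : set G)
    (O : set (gyroquotient H)) : open O = open (gyroproj H @^-1` O).
Proof. by []. Qed.

Definition open_map (X Y : topologicalType) (f : X -> Y) : Prop :=
  forall U : set X, open U -> open (f @` U).

Definition homeomorphism (X Y : topologicalType) (f : X -> Y) : Prop :=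
  continuous f /\
  exists g : Y -> X, [/\ cancel f g, cancel g f & continuous g].

Definition homogeneous_space (X : topologicalType) : Prop :=
  forall x y : X, exists f : X -> X, homeomorphism f /\ f x = y.

(* Main.v *)
Require Import Defs.
From mathcomp Require Import all_boot.
From mathcomp Require Import all_classical.
From mathcomp Require Import topology.

Local Open Scope classical_set_scope.
Local Open Scope quotient_scope.

(** Left translations of a gyrogroup are invertible, with inverse the left
    translation by [⊖ a].  Since [H] is invariant under gyrations, the coset of
    [a] is determined by any of its elements, and left translations permute the
    cosets.  Hence the saturation of an open set [U] is the union over [h \in H]
    of the preimages of [U] under [x |-> x ⊕ h], which is open; the left
    translations descend to homeomorphisms of [G/H], whose composites act
    transitively; and each coset is the preimage of the closed set [H] under a
    left translation. *)

Lemma gyroadd0x {G : gyrogroupType} (x : G) : gyrozero ⊕ x = x.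
Proof. by case: (gyro_id gyrogroupP x). Qed.

Lemma gyroaddx0 {G : gyrogroupType} (x : G) : x ⊕ gyrozero = x.
Proof. by case: (gyro_id gyrogroupP x). Qed.

Lemma gyroaddNx {G : gyrogroupType} (x : G) : ⊖ x ⊕ x = gyrozero.
Proof. by case: (gyro_inv gyrogroupP x). Qed.

Lemma gyroaddxN {G : gyrogroupType} (x : G) : x ⊕ ⊖ x = gyrozero.
Proof. by case: (gyro_inv gyrogroupP x). Qed.

Lemma gyroaddA {G : gyrogroupType} (x y z : G) :
  x ⊕ (y ⊕ z) = (x ⊕ y) ⊕ gyr x y z.
Proof. exact: (gyro_assoc gyrogroupP). Qed.

(** Adding [⊖ x] on the left and reassociating leaves the two values of [gyr (⊖ x) x], and gyrations
    are injective. *)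
Lemma gyroaddI {G : gyrogroupType} (x : G) : injective (gyroadd x).
Proof.
move=> y z /(congr1 (gyroadd (⊖ x))).
rewrite !gyroaddA gyroaddNx !gyroadd0x.
by case: (gyro_aut (@gyrogroupP G) (⊖ x) x) => /bij_inj + _; apply.
Qed.

Lemma gyr0 {G : gyrogroupType} (x z : G) : gyr gyrozero x z = z.
Proof.
by apply: (@gyroaddI G x); rewrite -{1}(gyroadd0x x) -gyroaddA gyroadd0x.
Qed.

Lemma gyroaddK {G : gyrogroupType} (x : G) :
  cancel (gyroadd x) (gyroadd (⊖ x)).
Proof.
move=> y; rewrite gyroaddA gyroaddNx gyroadd0x.
(* The loop property turns [gyr (⊖ x) x] into [gyr (⊖ x ⊕ x) x], that is [gyr gyrozero x], which is
   the identity map. *)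
by rewrite -(gyro_loop gyrogroupP) gyroaddNx gyr0.
Qed.

Lemma gyrooppK {G : gyrogroupType} : involutive (@gyroopp G).
Proof.
by move=> x; apply: (@gyroaddI G (⊖ x)); rewrite gyroaddxN gyroaddNx.
Qed.

Lemma gyroaddNK {G : gyrogroupType} (x : G) :
  cancel (gyroadd (⊖ x)) (gyroadd x).
Proof. by move=> y; rewrite -{1}(gyrooppK x) gyroaddK. Qed.

Section Subgyrogroup.
Context {G : gyrogroupType} {H : set G}.
Hypothesis sH : subgyrogroup H.

Lemma subgyro_add (x y : G) : H x -> H y -> H (x ⊕ y).
Proof.
case: sH => _ _ [op [opE _]] Hx Hy.
have := opE (SigSub (mem_set Hx)) (SigSub (mem_set Hy)).
by rewrite !set_valE /= => <-; exact: set_valP.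
Qed.

(** By left cancellation, the identity [e] and the inverses of the induced structure are those of
    [G]: [e ⊕ e = e = e ⊕ gyrozero], and then [x ⊕ inv x = gyrozero = x ⊕ ⊖ x]. *)
Lemma subgyro_zero_opp : H gyrozero /\ forall x, H x -> H (⊖ x).
Proof.
case: sH => _ _ [op [opE [e [inv [g ax]]]]].
have e0 : set_val e = gyrozero.
  apply: (@gyroaddI G (set_val e)); rewrite -opE gyroaddx0.
  by case: (gyro_id ax e) => ->.
split=> [|x Hx]; first by rewrite -e0; exact: set_valP.
pose u : set_type H := SigSub (mem_set Hx).
suff -> : ⊖ x = set_val (inv u) by exact: set_valP.
apply: (@gyroaddI G x); rewrite gyroaddxN -e0.
by case: (gyro_inv ax u) => _ <-; rewrite opE.
Qed.

Lemma subgyro_zero : H gyrozero.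
Proof. by case: subgyro_zero_opp. Qed.

Lemma subgyro_opp (x : G) : H x -> H (⊖ x).
Proof. by case: subgyro_zero_opp => _; exact. Qed.

End Subgyrogroup.

Section Cosets.
Context {G : gyrogroupType} {H : set G}.
Hypothesis LH : strongly_L_subgyrogroup H.

Lemma lcosetP (a b : G) : lcoset a H b <-> H (⊖ a ⊕ b).
Proof.
split=> [[h Hh <-]|Hab]; first by rewrite gyroaddK.
by exists (⊖ a ⊕ b) => //; rewrite gyroaddNK.
Qed.

Lemma lcoset_refl (a : G) : lcoset a H a.
Proof. by exists gyrozero; [exact: (subgyro_zero LH.1)|exact: gyroaddx0]. Qed.

Lemma lcoset_gyroadd (a x y : G) :
  lcoset x H y -> lcoset (a ⊕ x) H (a ⊕ y).
Proof.
(* Reassociating [a ⊕ (x ⊕ h)] produces [gyr a x h], which stays in [H] by gyration invariance. *)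
move=> [h Hh <-]; exists (gyr a x h); last by rewrite gyroaddA.
by apply: LH.2; exists h.
Qed.

Lemma lcoset_sub (a b : G) : lcoset a H b -> lcoset a H `<=` lcoset b H.
Proof.
move=> [h Hh <-] _ [k Hk <-].
(* Since [k = h ⊕ (⊖ h ⊕ k)] lies in the coset of [h], translating by [a] puts [a ⊕ k] in the coset
   of [a ⊕ h]. *)
rewrite -(gyroaddNK h k); apply: lcoset_gyroadd.
exists (⊖ h ⊕ k) => //.
by apply: subgyro_add LH.1 _ _ _ Hk; exact: (subgyro_opp LH.1).
Qed.

Lemma lcoset_eqP (a b : G) : lcoset a H = lcoset b H <-> lcoset a H b.
Proof.
split=> [->|ab]; first exact: lcoset_refl.
apply/seteqP; split; first exact: lcoset_sub.
(* The first inclusion, applied to [a] itself, gives the symmetric membership of [a] in the coset of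
   [b]. *)
by apply: lcoset_sub; apply: (lcoset_sub _ _ ab); exact: lcoset_refl.
Qed.

End Cosets.

Section Quotient.
Context {G : topologicalGyrogroupType} {H : set G}.
Hypothesis LH : strongly_L_subgyrogroup H.

Lemma gyroproj_eqP (a b : G) : gyroproj H a = gyroproj H b <-> lcoset a H b.
Proof.
split=> [/(congr1 (fun A : coset_space H => set_val A))|/(lcoset_eqP LH) ab].
  by rewrite !val_gyroproj => /(lcoset_eqP LH).
(* [gyroquotient H] is also a subtype of [G] through [repr], so the subtype
   whose [val] is meant must be given. *)
by rewrite !gyroprojE; exact: (@val_inj _ _ (set_type (lcosets H))).
Qed.

Lemma gyroaddl_continuous (a : G) : continuous (gyroadd a).
Proof.
move=> x.
apply: (@continuous_comp _ _ _ (fun x : G => (a, x)) (fun p => p.1 ⊕ p.2)).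
  by apply: cvg_pair => //=; exact: cvg_cst.
exact: gyroadd_continuous.
Qed.

Lemma gyroaddr_continuous (a : G) : continuous (fun x : G => x ⊕ a).
Proof.
move=> x.
apply: (@continuous_comp _ _ _ (fun x : G => (x, a)) (fun p => p.1 ⊕ p.2)).
  by apply: cvg_pair => //=; exact: cvg_cst.
exact: gyroadd_continuous.
Qed.

Lemma gyroproj_open : open_map (gyroproj H : G -> gyroquotient H).
Proof.
move=> U oU; rewrite open_gyroquotient.
have -> : gyroproj H @^-1` (gyroproj H @` U) =
    \bigcup_(h in H) ((fun x => x ⊕ h) @^-1` U).
  apply/seteqP; split=> [x [u Uu /esym/gyroproj_eqP [h Hh hu]]|x [h Hh Uxh]].
    by exists h => //=; rewrite hu.
  by exists (x ⊕ h) => //; apply/esym/gyroproj_eqP; exists h.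
apply: bigcup_open => h _.
by apply: open_comp oU => x _; exact: gyroaddr_continuous.
Qed.

Definition coset_shift (a : G) (A : gyroquotient H) : gyroquotient H :=
  gyroproj H (a ⊕ repr A).

(** The choice made by [repr] is harmless: the chosen representative lies in the coset of [x], and
    left translation preserves this relation. *)
Lemma coset_shiftE (a x : G) :
  coset_shift a (gyroproj H x) = gyroproj H (a ⊕ x).
Proof.
by apply/gyroproj_eqP/(lcoset_gyroadd LH)/gyroproj_eqP; rewrite reprK.
Qed.

Lemma coset_shift_continuous (a : G) : continuous (coset_shift a).
Proof.
apply/continuousP => O oO; rewrite open_gyroquotient.
have -> : gyroproj H @^-1` (coset_shift a @^-1` O) =
    gyroadd a @^-1` (gyroproj H @^-1` O).
  by apply/funext => x /=; rewrite coset_shiftE.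
by apply: open_comp => // x _; exact: gyroaddl_continuous.
Qed.

Lemma coset_shiftK (a : G) : cancel (coset_shift a) (coset_shift (⊖ a)).
Proof. by move=> A; rewrite -[A]reprK (coset_shiftE a) coset_shiftE gyroaddK. Qed.

Lemma coset_shiftNK (a : G) : cancel (coset_shift (⊖ a)) (coset_shift a).
Proof. by move=> A; rewrite -[A]reprK (coset_shiftE (⊖ a)) coset_shiftE gyroaddNK. Qed.

Lemma gyroquotient_homogeneous : homogeneous_space (gyroquotient H).
Proof.
(* The first shift takes [A] to the coset of [gyrozero], the second takes that coset to [B]. *)
move=> A B; exists (coset_shift (repr B) \o coset_shift (⊖ repr A)); split.
  split.
    by move=> C; apply: continuous_comp; exact: coset_shift_continuous.
  exists (coset_shift (repr A) \o coset_shift (⊖ repr B)); split.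
  - by move=> C /=; rewrite coset_shiftK coset_shiftNK.
  - by move=> C /=; rewrite coset_shiftK coset_shiftNK.
  - by move=> C; apply: continuous_comp; exact: coset_shift_continuous.
rewrite /= -{2}[A]reprK (coset_shiftE (⊖ repr A)) coset_shiftE.
by rewrite gyroaddNx gyroaddx0 reprK.
Qed.

Lemma gyroquotient_accessible : closed H -> accessible_space (gyroquotient H).
Proof.
(* It suffices that the point [B] is closed, which is read off from its fibre in [G]. *)
move=> cH A B AB; exists (~` [set B]); split.
- rewrite open_gyroquotient.
  have -> : gyroproj H @^-1` (~` [set B]) = ~` (gyroadd (⊖ repr B) @^-1` H).
    rewrite preimage_setC; congr (~` _).
    apply/seteqP; split=> [x /= xB|x /lcosetP/gyroproj_eqP /= <-].
      by apply/lcosetP/gyroproj_eqP; rewrite reprK.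
    exact: reprK.
  apply: closed_openC; apply: preimage_closed cH => x _.
  exact: gyroaddl_continuous.
- by apply/mem_set; exact/eqP.
- by apply/mem_set => /=; exact.
Qed.

End Quotient.

Theorem theorem3p5 (G : topologicalGyrogroupType) (hG : hausdorff_space G)
    (H : set G) (cH : closed H) (LH : strongly_L_subgyrogroup H) :
  [/\ open_map (gyroproj H : G -> gyroquotient H),
      continuous (gyroproj H : G -> gyroquotient H),
      homogeneous_space (gyroquotient H)
    & accessible_space (gyroquotient H)].
Proof.
split.
- exact: gyroproj_open.
- exact: pi_continuous.
- exact: gyroquotient_homogeneous.
- exact: gyroquotient_accessible.
Qed.
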